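(* Let $m$ be a positive integer and $\lambda$ a nonzero real number. For integers $n,k\ge0$, $$\frac{1}{k!m^{k}}\sum_{l=0}^{k}\binom{k}{l}(-1)^{k-l}(lm+1)_{n,\lambda}=\begin{cases}W_{m,\lambda}(n,k),& n\ge k,\\ 0,& \text{otherwise.}\end{cases}$$
   Context: For a nonzero real $\lambda$: $(x)_{0,\lambda}=1$, $(x)_{n,\lambda}=x(x-\lambda)\cdots(x-(n-1)\lambda)$; $(x)_n=(x)_{n,1}$. Degenerate Whitney numbers of the second kind $W_{m,\lambda}(n,k)$ ($0\le k\le n$): $(mx+1)_{n,\lambda}=\sum_{k=0}^{n}W_{m,\lambda}(n,k)m^{k}(x)_{k}$. *)

(* Defs.v *)
From HB Require Import structures.
From mathcomp Require Import all_boot all_order all_algebra.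
From mathcomp Require Import reals.
From mathcomp Require Import ring.
Set Implicit Arguments.
Unset Strict Implicit.
Unset Printing Implicit Defensive.
Import Order.TTheory GRing.Theory Num.Theory.
Local Open Scope ring_scope.

Definition degen_falling (R : realType) (lam x : R) (n : nat) : R :=
  \prod_(i < n) (x - i%:R * lam).

Definition falling (R : realType) (x : R) (n : nat) : R := degen_falling 1 x n.

(* The degenerate Whitney numbers of the second kind are the coefficients of
   (m x + 1)_{n,lam} in the basis m^k (x)_k.  Only the values W n k with
   k <= n are constrained. *)
Definition degen_whitney2 (R : realType) (m : nat) (lam : R)
    (W : nat -> nat -> R) : Prop :=
  forall (n : nat) (x : R),
    degen_falling lam (m%:R * x + 1) n =
    \sum_(k < n.+1) W n k * m%:R ^+ k * falling x k.

Lemma degen_whitney2_exists (R : realType) (m : nat) (lam : R) :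
  exists W : nat -> nat -> R, degen_whitney2 m lam W.
Proof.
pose step n (w : nat -> R) k : R :=
  (if k is j.+1 then w j else 0) + (m%:R * k%:R + 1 - n%:R * lam) * w k.
pose fix W n : nat -> R :=
  if n is p.+1 then step p (W p) else fun k => (k == 0%N)%:R.
have W0 n k : (n < k)%N -> W n k = 0.
  elim: n k => [|n IH] [|k] //= nk; rewrite /step.
  by rewrite !IH ?mulr0 ?addr0 // ltnW.
exists W => n x; elim: n => [|n IH].
  by rewrite big_ord1 /falling /degen_falling !big_ord0 /= expr0 !mulr1.
rewrite {1}/degen_falling big_ord_recr /= -/(degen_falling _ _ _) IH mulr_suml.
under [RHS]eq_bigr => k _ do rewrite /step mulrDl mulrDl.
rewrite big_split /= [X in _ = X + _]big_ord_recl /= !mul0r add0r.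
rewrite [X in _ = _ + X]big_ord_recr /= (W0 n n.+1) // mulr0 !mul0r addr0.
rewrite -big_split /=; apply: eq_bigr => k _.
by rewrite /falling /degen_falling big_ord_recr /= /bump /= add1n exprS; ring.
Qed.

(* Main.v *)
Require Import Defs.
From HB Require Import structures.
From mathcomp Require Import all_boot all_order all_algebra.
From mathcomp Require Import reals.
Import Order.TTheory GRing.Theory Num.Theory.
Local Open Scope ring_scope.

(* The k-th finite difference at 0 of x |-> (x)_j is k! if j = k and 0
   otherwise, so applying it to the expansion of (m x + 1)_{n,lam} in the basis
   m^j (x)_j isolates k! m^k W n k. *)

(** The difference only samples (x)_j at integers [l], where it equals j! C(l, j) ([falling_nat]).
    The claim on differences, [alternating_sum_falling], thus reduces to binomial orthogonality,
    [alternating_sum_bin_bin]. *)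

Lemma coef_XaddC1_exp (R : comNzRingType) (n j : nat) :
  (('X + 1 : {poly R}) ^+ n)`_j = 'C(n, j)%:R.
Proof.
rewrite addrC exprDn.
under eq_bigr => i _ do rewrite expr1n mul1r -scaler_nat.
rewrite -(poly_def n.+1 (fun i => 'C(n, i)%:R)) coef_poly.
by case: ltnP => // nj; rewrite bin_small.
Qed.

(* Compare the coefficients of X^j in X^k = ((X + 1) - 1)^k. *)
Lemma alternating_sum_bin_bin (R : comNzRingType) (k j : nat) :
  \sum_(l < k.+1) 'C(k, l)%:R * (-1) ^+ (k - l) * 'C(l, j)%:R
  = (j == k)%:R :> R.
Proof.
have <- : ('X^k : {poly R})`_j = (j == k)%:R by rewrite coefXn.
rewrite -[X in X ^+ k](addKr 1) exprDn coef_sum.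
apply: eq_bigr => l _.
rewrite -scaler_nat coefZ -(rmorphN1 (@polyC R)) -rmorphXn coefCM.
by rewrite addrC coef_XaddC1_exp mulrA.
Qed.

Lemma falling_nat (R : realType) (l j : nat) :
  falling (l%:R : R) j = 'C(l, j)%:R * j`!%:R.
Proof.
rewrite -natrM bin_ffact /falling /degen_falling.
elim: j => [|j IH]; first by rewrite big_ord0.
rewrite big_ord_recr /= IH mulr1 ffactnSr natrM.
(* The truncated [l - j] is the true difference only for j <= l; beyond that the falling factorial
   already vanishes. *)
have [jl|lj] := leqP j l; first by rewrite natrB.
by rewrite ffact_small // !mul0r.
Qed.

Lemma alternating_sum_falling (R : realType) (k j : nat) :
  \sum_(l < k.+1) 'C(k, l)%:R * (-1) ^+ (k - l) * falling l%:R j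
  = (j == k)%:R * k`!%:R :> R.
Proof.
under eq_bigr => l _ do rewrite falling_nat mulrA.
rewrite -mulr_suml alternating_sum_bin_bin.
by case: eqP => [->|]; rewrite ?mul0r.
Qed.

Theorem theorem12 (R : realType) (m : nat) (lam : R) (W : nat -> nat -> R)
    (m_gt0 : (0 < m)%N) (lam_neq0 : lam != 0)
    (W_whitney : degen_whitney2 m lam W) (n k : nat) :
  (k`!%:R * m%:R ^+ k)^-1 *
    (\sum_(l < k.+1)
        'C(k, l)%:R * (-1) ^+ (k - l) * degen_falling lam (l%:R * m%:R + 1) n) =
  (if (k <= n)%N then W n k else 0).
Proof.
under eq_bigr => l _ do rewrite (mulrC l%:R) W_whitney mulr_sumr.
(* With j outermost, the inner sum over [l] is the k-th difference of (x)_j at 0. *)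
rewrite exchange_big /=.
under eq_bigr => j _.
  under eq_bigr => l _ do rewrite mulrCA.
  rewrite -mulr_sumr alternating_sum_falling.
  over.
have km_neq0 : k`!%:R * m%:R ^+ k != 0 :> R.
  by rewrite mulf_neq0 ?expf_neq0 // pnatr_eq0 -lt0n ?fact_gt0.
case: (leqP k n) => [kn|nk].
  have kn1 : (k < n.+1)%N by [].
  rewrite (bigD1 (Ordinal kn1)) //= big1 ?addr0 => [|j]; last first.
    by rewrite -val_eqE /= => /negPf ->; rewrite mul0r mulr0.
  by rewrite eqxx mul1r -mulrA (mulrC (_ ^+ k)) mulrCA mulVf ?mulr1.
(* Here every j <= n is below [k], so no term has j = k. *)
rewrite big1 ?mulr0 // => j _.
by rewrite ltn_eqF ?mul0r ?mulr0 // (leq_trans (ltn_ord j)).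
Qed.
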